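(* Let $H$ be a collection of probability measures on a measurable space $\mathcal{X}$, let $Q$ be a probability measure on $\mathcal{X}$ with generalized Lebesgue decomposition $Q=Q_a+Q_s$ with respect to $H$, and let $U:[0,\infty]\to[-\infty,\infty]$ be measurable. Suppose that $U$ is concave, upper semicontinuous and finite on $(0,\infty)$, and assume there exists some $K\ge 0$ such that $$U(y)-U(x)\le K\log(y/x),\quad\text{for } 1\le x\le y<\infty.$$ Then a $U$-optimal e-value for $H$ exists.
   Context: Notation: $\mathrm{E}^\mu[f]=\int f\,d\mu$ for any nonnegative measure $\mu$. Concavity and upper semicontinuity of $U$ are understood on $[0,\infty)$ (valid e-values are finite $Q_a$-a.s., so $U(\infty)$ is immaterial); ''finite on $(0,\infty)$'' allows $U(0)=-\infty$. An event is $H$-negligible if it has probability zero under every $P\in H$. The generalized Lebesgue decomposition of $Q$ with respect to $H$ is $Q=Q_a+Q_s$, where the nonnegative measure $Q_s$ is concentrated on an $H$-negligible event and the nonnegative measure $Q_a$ assigns zero mass to every $H$-negligible event. The class of valid e-values for $H$ is $\mathcal{E}(H)=\{\varepsilon:\mathcal{X}\to[0,\infty]\ \text{measurable}: \mathrm{E}^P[\varepsilon]\le 1\ \text{for all } P\in H\}$. A valid e-value $\varepsilon^*\in\mathcal{E}(H)$ is $U$-optimal (against $Q_a$) if, for every $\varepsilon\in\mathcal{E}(H)$, $\mathrm{E}^{Q_a}[U(\varepsilon^* )-U(\varepsilon)]$ is well-defined and $\ge 0$. Here ''well-defined'' means that the integrand avoids an ambiguous $\infty-\infty$ $Q_a$-almost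 surely, and that its positive part or its negative part has finite $Q_a$-expectation. *)

(* Defs.v *)
From mathcomp Require Import all_boot all_order all_algebra.
From mathcomp Require Import all_classical all_reals all_analysis.
From mathcomp Require Import measurable_realfun.
Set Implicit Arguments.
Unset Strict Implicit.
Unset Printing Implicit Defensive.
Import Order.TTheory GRing.Theory Num.Theory.
Import numFieldNormedType.Exports.
Local Open Scope classical_set_scope.
Local Open Scope ring_scope.
Local Open Scope ereal_scope.

Definition H_negligible (d : measure_display) (X : measurableType d)
    (R : realType) (H : set (probability X R)) (N : set X) : Prop :=
  measurable N /\ forall P : probability X R, H P -> P N = 0.

Definition generalized_lebesgue_decomposition (d : measure_display)
    (X : measurableType d) (R : realType) (H : set (probability X R))
    (Q : probability X R) (Qa Qs : {measure set X -> \bar R}) : Prop :=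
  [/\ forall A : set X, measurable A -> Q A = Qa A + Qs A,
      exists2 N : set X, H_negligible H N & Qs (~` N) = 0 &
      forall N : set X, H_negligible H N -> Qa N = 0].

Definition e_values (d : measure_display) (X : measurableType d)
    (R : realType) (H : set (probability X R)) : set (X -> \bar R) :=
  [set e : X -> \bar R | [/\ measurable_fun [set: X] e,
               forall x : X, 0 <= e x &
               forall P : probability X R, H P -> \int[P]_x e x <= 1]].

(* Any value given by the library's conventions to [+oo - +oo] or [-oo - -oo]
   is excluded [mu]-almost everywhere by the first clause. *)
Definition well_defined_diff_expectation (d : measure_display)
    (X : measurableType d) (R : realType) (mu : {measure set X -> \bar R})
    (f g : X -> \bar R) : Prop :=
  {ae mu, forall x : X, f x +? - g x} /\
  (\int[mu]_x (f \- g)^\+ x < +oo \/ \int[mu]_x (f \- g)^\- x < +oo).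

Definition U_optimal (d : measure_display) (X : measurableType d)
    (R : realType) (H : set (probability X R))
    (Qa : {measure set X -> \bar R}) (U : \bar R -> \bar R)
    (estar : X -> \bar R) : Prop :=
  e_values H estar /\
  forall e : X -> \bar R, e_values H e ->
    well_defined_diff_expectation Qa (U \o estar) (U \o e) /\
    0 <= \int[Qa]_x (U (estar x) - U (e x)).

(* The weights are taken in ]0, 1[, so that no product [0 * -oo] occurs. *)
Definition concave_on (R : realType) (D : set R) (f : R -> \bar R) : Prop :=
  forall x y t : R, D x -> D y -> (0 < t < 1)%R ->
    t%:E * f x + (1 - t)%:E * f y <= f (t * x + (1 - t) * y)%R.

Definition upper_semicontinuous_on (R : realType) (D : set R)
    (f : R -> \bar R) : Prop :=
  forall x a : R, D x -> f x < a%:E ->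
    \forall y \near within D (nbhs x), f y < a%:E.

(* Main.v *)
Require Import Defs.
From mathcomp Require Import all_boot all_order all_algebra.
From mathcomp Require Import all_classical all_reals all_analysis.
From mathcomp Require Import measurable_realfun ring lra.
Import Order.TTheory GRing.Theory Num.Theory.
Import numFieldNormedType.Exports.
Set Implicit Arguments.
Unset Strict Implicit.
Unset Printing Implicit Defensive.
Local Open Scope classical_set_scope.
Local Open Scope ring_scope.
Local Open Scope ereal_scope.
(** Why an optimal e-value exists. Write mu for the absolutely continuous part
Q_a, a measure of mass at most 1 that vanishes on every H-negligible set, and C
for the real-valued e-values. An extended e-value is mu-almost everywhere equal
to an element of C, since it is infinite only on an H-negligible set.

Compactness ([ae_cvg_selection]). A decreasing sequence D_k of nonempty
midpoint-closed subsets of C contains f_k in D_k converging mu-almost everywhere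
to some g in C. This replaces a Komlos-type theorem: near-minimizers of the
strictly convex functional f |-> E[1/(1+f)] over the D_k form a fast L2-Cauchy
sequence after the transform 1/(1+x), so 1/(1+f_k) converges almost everywhere.
The limit does not vanish, because by Fatou under each P in H the lower limit of
the f_k is again an e-value, hence finite mu-almost everywhere.

Numeraire ([numeraire_exists]). There is z in C, bounded below by 1/2 almost
everywhere, with E[f / max(z,1)] <= 4 for all f in C. At truncation level k, a
near-maximizer of E[ln f] over the e-values with values in [1/2, k+1] satisfies
an approximate first-order condition, which bounds E[min(f,k)/z_k] for all f in C.
The e-values z_k >= 1/2 with this bound form a midpoint-closed set by convexity
of 1/x, so the selection lemma and Fatou provide the limit.

Optimization ([exists_optimum]). Measure the utility relative to a finite
reference v: the gain is V(f) - v, where V is U restricted to the reals. If for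
every eta > 0 the gain is at most a_eta + eta * f/w, with E[f/w] bounded over C,
then the positive parts of the gains are uniformly integrable over C. The
superlevel sets of the concave functional E[gain] are midpoint-closed, so a
maximizing sequence may be taken almost everywhere convergent, and Fatou with
upper semicontinuity shows that its limit attains the supremum. Letting eta tend
to 0 removes the loss caused by the linear term.

Choice of the reference ([exists_U_optimal]). If V is bounded above, v = V(1)
works, and the e-value 1 has gain 0. Otherwise a concave V is nondecreasing, and
v = V(max(z,1)) works: the logarithmic growth condition makes the gain sublinear
in f / max(z,1), and the gain of z is almost everywhere at least V(1/2) - V(1). As
the optimal gain has a finite integral, comparing gains is the same as comparing utilities, even
when E[U(f)] itself is infinite ([U_optimal_of_gain_optimal]). *)

(** * Lower limits and Fatou's lemma *)

Section limit_inferior.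
Context {R : realType}.
Implicit Types (u v : (\bar R)^nat) (l : \bar R).

Lemma limn_einf_ge u l :
  (forall b : R, b%:E < l -> \forall k \near \oo, b%:E <= u k) ->
  l <= limn_einf u.
Proof.
move=> ul.
have ge_inf b : b%:E < l -> b%:E <= limn_einf u.
  move=> /ul[N _ Nu]; rewrite limn_einf_lim; apply: lime_ge.
    exact: is_cvg_einfs.
  near=> n; apply: le_ereal_inf_tmp => _ [k /= nk <-].
  by apply: Nu => /=; apply: leq_trans nk; near: n; exact: nbhs_infty_ge.
case: l ul ge_inf => [r| |] _ ge_inf; last by rewrite leNye.
- apply/lee_addgt0Pr => e e0; rewrite -leeBlDr//.
  by apply: ge_inf; rewrite lte_fin ltrBlDr ltrDl.
- by rewrite leye_eq; apply/eqP/eqyP => b _; apply: ge_inf; rewrite ltry.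
Unshelve. all: by end_near. Qed.

Lemma le_limn_einf u v : (forall k, u k <= v k) -> limn_einf u <= limn_einf v.
Proof.
move=> uv; rewrite !limn_einf_lim; apply: lee_lim; try exact: is_cvg_einfs.
near=> n; apply: le_ereal_inf_tmp => _ [k /= nk <-].
by apply: le_trans (uv k); apply: ereal_inf_lbound; exists k.
Unshelve. all: by end_near. Qed.

Lemma limn_einf_ge0 u : (forall k, 0 <= u k) -> 0 <= limn_einf u.
Proof.
move=> u0; apply: limn_einf_ge => b b0; near=> k.
by apply: le_trans (u0 k); exact: ltW.
Unshelve. all: by end_near. Qed.

End limit_inferior.

Section measure_facts.
Context d (X : measurableType d) (R : realType).
Variable mu : {measure set X -> \bar R}.

Lemma measurable_fun_limn_einf (f : (X -> \bar R)^nat) :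
  (forall k, measurable_fun [set: X] (f k)) ->
  measurable_fun [set: X] (fun x => limn_einf (f^~ x)).
Proof.
move=> mf; apply: (@measurableT_comp _ _ _ _ _ _ -%E); first exact: oppe_measurable.
apply: measurable_fun_limn_esup => k.
by apply: (@measurableT_comp _ _ _ _ _ _ -%E) => //; exact: oppe_measurable.
Qed.

Lemma measurable_fun_inv (f : X -> R) : measurable_fun [set: X] f ->
  (forall x, (0 <= f x)%R) -> measurable_fun [set: X] (fun x => (f x)^-1)%R.
Proof.
move=> mf f0.
rewrite (_ : (fun x => _) = (fun x => f x `^ (-1))%R); last first.
  by apply/funext => x; rewrite powR_inv1.
by apply: (measurableT_comp (measurable_powR _)).
Qed.

(** Fatou in the form used for maximizing sequences, where the k-th integral
exceeds its target by at most 1/(k+1). *)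
Lemma fatou_le (f : (X -> \bar R)^nat) (g : X -> \bar R) (c : R) :
  (forall k, measurable_fun [set: X] (f k)) -> (forall k x, 0 <= f k x) ->
  measurable_fun [set: X] g -> (forall x, 0 <= g x) ->
  {ae mu, forall x, g x <= limn_einf (f^~ x)} ->
  (forall k, \int[mu]_x f k x <= (c + k.+1%:R^-1)%:E) ->
  \int[mu]_x g x <= c%:E.
Proof.
move=> mf f0 mg g0 gf fc.
have /cvg_limn_einf_sup[<- _] :
    (c + k.+1%:R^-1)%:E @[k --> \oo] --> c%:E.
  apply/cvg_EFin; first by near=> k.
  rewrite -[X in _ --> X]addr0; apply: cvgD; first exact: cvg_cst.
  exact: cvg_harmonic.
apply: le_trans (le_limn_einf fc).
apply: le_trans (fatou mu measurableT mf (fun k x _ => f0 k x)).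
apply: ae_ge0_le_integral => //.
- by move=> x _; exact: limn_einf_ge0.
- exact: measurable_fun_limn_einf.
- by apply: filterS gf.
Unshelve. all: by end_near. Qed.

End measure_facts.

(** * Fast Cauchy sequences in mean square *)

Section fast_cauchy.
Context d (X : measurableType d) (R : realType).
Variable mu : {measure set X -> \bar R}.
Hypothesis mu_le1 : mu [set: X] <= 1.

Lemma cvg_of_summable_steps (q : R^nat) :
  \sum_(k <oo) `|q k.+1 - q k|%:E \is a fin_num -> cvgn q.
Proof.
move=> qfin; set S := \sum_(_ <oo) _ in qfin.
have cvd : cvgn (series (telescope q)).
  apply: normed_cvg; apply: nondecreasing_is_cvgn.
    apply/nondecreasing_seqP => n.
    by rewrite /= /series /= big_nat_recr//= lerDl.
  exists (fine S) => _ [n _ <-]; rewrite -lee_fin fineK//.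
  rewrite /series /= -sumEFin; apply: nneseries_lim_ge => k _ _.
  by rewrite lee_fin.
rewrite (_ : q = (fun n => q 0%N + series (telescope q) n)%R).
  by apply: is_cvgD => //; exact: is_cvg_cst.
by apply/funext => n; rewrite -eq_sum_telescope.
Qed.

(** Mean-square steps at most 4^-(k+1) have mean absolute value at most
2 / 2^(k+1), so the sum of the absolute steps is integrable, hence finite almost
everywhere. *)
Lemma ae_cvg_fast_cauchy (q : (X -> R)^nat) :
  (forall k, measurable_fun [set: X] (q k)) ->
  (forall k, \int[mu]_x ((q k x - q k.+1 x) ^+ 2)%:E
             <= (((2 ^ k.+1)%:R^-1) ^+ 2)%:E) ->
  {ae mu, forall x, cvgn (q^~ x)}.
Proof.
move=> mq qL2.
have md k : measurable_fun [set: X] (fun x => (q k.+1 x - q k x)%R).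
  exact: measurable_funB.
have mn k : measurable_fun [set: X] (fun x => `|q k.+1 x - q k x|%:E).
  by apply/measurable_EFinP; exact: (measurableT_comp (@normr_measurable _ _)).
have n0 k x : [set: X] x -> 0 <= `|q k.+1 x - q k x|%:E by rewrite lee_fin.
have L1 k : \int[mu]_x `|q k.+1 x - q k x|%:E <= (2 / (2 ^ k.+1)%:R)%:E.
  set e := ((2 ^ k.+1)%:R^-1)%R : R.
  have e0 : (0 < e)%R by rewrite invr_gt0 ltr0n expn_gt0.
  (* AM-GM: |y| <= e + y^2 / e, with e the expected size of the step. *)
  pose h x := (e%:E + (e^-1)%:E * ((q k x - q k.+1 x) ^+ 2)%:E).
  have ms : measurable_fun [set: X] (fun x => ((q k x - q k.+1 x) ^+ 2)%:E).
    by apply/measurable_EFinP; apply: measurable_funX; exact: measurable_funB.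
  have mes : measurable_fun [set: X]
      (fun x => (e^-1)%:E * ((q k x - q k.+1 x) ^+ 2)%:E).
    by apply/measurable_EFinP; apply: measurable_funM => //; exact/measurable_EFinP.
  apply: (@le_trans _ _ (\int[mu]_x h x)).
    apply: ge0_le_integral => //; first exact: emeasurable_funD.
    move=> x _; rewrite /h -EFinM -EFinD lee_fin distrC.
    set y := (q k x - q k.+1 x)%R.
    have : (0 <= (`|y| - e) ^+ 2)%R by exact: sqr_ge0.
    rewrite sqrrB real_normK ?num_real// => h0.
    have y0 : (0 <= e * `|y|)%R by rewrite mulr_ge0// ltW.
    rewrite -(ler_pM2l e0) mulrDr mulrA divff ?gt_eqF// mul1r.
    lra.
  rewrite ge0_integralD//; last 2 first.
  - by move=> x _; rewrite lee_fin ltW.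
  - by move=> x _; rewrite -EFinM lee_fin mulr_ge0 ?sqr_ge0// invr_ge0 ltW.
  rewrite ge0_integralZl_EFin//; last 2 first.
  - by move=> x _; rewrite lee_fin sqr_ge0.
  - by rewrite invr_ge0 ltW.
  rewrite integral_cst// mulr2n mulrDl !mul1r EFinD -/e; apply: leeD.
    by rewrite -[leRHS]mule1 lee_pmul2l// lte_fin.
  apply: (@le_trans _ _ ((e^-1)%:E * (e ^+ 2)%:E)).
    by rewrite lee_pmul2l ?lte_fin ?invr_gt0//; exact: qL2.
  by rewrite -EFinM expr2 mulrA mulVf ?gt_eqF// mul1r.
have Sfin : mu.-integrable [set: X]
    (fun x => \sum_(k <oo) `|q k.+1 x - q k x|%:E).
  apply/integrableP; split.
    exact: ge0_emeasurable_sum.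
  under eq_integral do rewrite gee0_abs ?nneseries_ge0//.
  rewrite integral_nneseries//.
  apply: (@le_lt_trans _ _ 2%:E); last by rewrite ltry.
  apply: le_trans (epsilon_trick0 xpredT _) => //.
  by apply: lee_nneseries => // k _ _; exact: integral_ge0.
apply: filterS (integrable_ae measurableT Sfin) => x xfin.
exact/cvg_of_summable_steps/xfin.
Qed.

End fast_cauchy.

(** * Near-minimizers and the transform 1/(1+x) *)

Section near_minimizers.
Context {R : realType} {T : Type}.

(** With i the supremum of the infima of Phi over the D_k, late sets have infimum
close to i, so that one tolerance e bounds Phi from both sides there. *)
Lemma near_minimizers (D : (set T)^nat) (Phi : T -> R) :
  (forall k, D k !=set0) -> (forall m n, (m <= n)%N -> D n `<=` D m) ->
  (forall k f, D k f -> (0 <= Phi f <= 1)%R) ->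
  exists i : R, forall k e, (0 < e)%R -> exists N f,
    [/\ (k <= N)%N, D N f, (Phi f <= i + e)%R &
        forall h, D N h -> (i - e <= Phi h)%R].
Proof.
move=> D0 Ddec Phi01.
have lb n : has_lbound (Phi @` D n).
  by exists 0%R => _ [f Df <-]; case/andP: (Phi01 _ _ Df).
have hi n : has_inf (Phi @` D n).
  by split => //; have [f Df] := D0 n; exists (Phi f); exists f.
pose j n := inf (Phi @` D n).
have j1 n : (j n <= 1)%R.
  have [f Df] := D0 n; case/andP: (Phi01 _ _ Df) => _; apply: le_trans.
  by apply: ge_inf => //; exists f.
have hs : has_sup (range j).
  by split; [exists (j 0%N); exists 0%N|exists 1%R => _ [n _ <-]].
exists (sup (range j)) => k e e0.
have [_ [n _ <-] jn] := sup_adherent e0 hs.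
have [_ [f Df <-] fe] := inf_adherent e0 (hi (maxn k n)).
exists (maxn k n), f; split; rewrite ?leq_maxl//.
  apply/ltW/(lt_le_trans fe); rewrite lerD2r.
  by apply: sup_upper_bound => //; exists (maxn k n).
move=> h Dh; apply/ltW/(lt_le_trans jn); apply: ge_inf => //; exists h => //.
by apply: Ddec Dh; rewrite leq_maxr.
Qed.

End near_minimizers.

Section real_facts.
Context {R : realType}.
Implicit Types (x y : R) (f : R^nat).

(** Strong convexity of the integrand: the convexity defect of 1/(1+x) at a
midpoint controls the squared distance of the transformed arguments. *)
Lemma inv1D_midpoint x y : (0 <= x)%R -> (0 <= y)%R ->
  (((1 + x)^-1 - (1 + y)^-1) ^+ 2 + 4 * (1 + (x + y) / 2)^-1
   <= 2 * (1 + x)^-1 + 2 * (1 + y)^-1)%R.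
Proof.
move=> x0 y0; set a := (1 + x)%R; set b := (1 + y)%R.
have a1 : (1 <= a)%R by rewrite lerDl.
have b1 : (1 <= b)%R by rewrite lerDl.
have a0 : (0 < a)%R by apply: lt_le_trans a1.
have b0 : (0 < b)%R by apply: lt_le_trans b1.
rewrite (_ : 1 + (x + y) / 2 = (a + b) / 2)%R; last by rewrite /a /b; field.
have ab0 : (0 < a + b)%R by rewrite addr_gt0.
(* What remains is 2ab - a - b >= 0, which holds since a, b >= 1. *)
rewrite -subr_ge0 (_ : (_ - _ = (a - b) ^+ 2 * (2 * a * b - a - b) /
    (a ^+ 2 * b ^+ 2 * (a + b)))%R); last by field; rewrite !gt_eqF.
apply: divr_ge0; last by rewrite (mulr_ge0 _ (ltW ab0))// mulr_ge0 ?sqr_ge0.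
rewrite mulr_ge0 ?sqr_ge0//.
rewrite (_ : _ - _ = a * (b - 1) + b * (a - 1))%R; last by ring.
by rewrite addr_ge0// mulr_ge0 ?subr_ge0// ltW.
Qed.

(** The transform tends to 0 only if f tends to infinity, which a finite lower
limit excludes; otherwise the transform can be inverted in the limit. *)
Lemma cvg_of_cvg_inv1D f : (forall k, 0 <= f k)%R ->
  cvgn (fun k => (1 + f k)^-1)%R -> limn_einf (EFin \o f) < +oo ->
  f @ \oo --> fine (limn_einf (EFin \o f)).
Proof.
move=> f0 /cvg_ex[/= p fp] liminfy.
have f1 k : (0 < 1 + f k)%R by rewrite ltr_pwDl.
have p0 : p != 0%R.
  apply/eqP => p0; move: fp; rewrite p0 => fp.
  have /cvg_limn_einf_sup[fy _] : (EFin \o f) k @[k --> \oo] --> +oo.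
    apply/cvgeyPge => A.
    have A0 : (0 < 1 + `|A|)%R by rewrite ltr_pwDl.
    have A1 : (0 < (1 + `|A|)^-1)%R by rewrite invr_gt0.
    move/cvgrPdist_lt : fp => /(_ _ A1); apply: filterS => k.
    rewrite sub0r normrN (@gtr0_norm _ (1 + f k)^-1%R) ?invr_gt0 ?f1//.
    rewrite (ltf_pV2 (f1 k) A0) ltrD2l /= lee_fin => /ltW.
    exact/le_trans/ler_norm.
  by move: liminfy; rewrite fy ltxx.
have fl : f @ \oo --> (p^-1 - 1)%R.
  rewrite (_ : f = (fun k => ((1 + f k)^-1)^-1 - 1)%R).
    by apply: cvgB; [exact: cvgV|exact: cvg_cst].
  by apply/funext => k; rewrite invrK addrC addKr.
have /cvg_limn_einf_sup[-> _] // : (EFin \o f) k @[k --> \oo] --> (p^-1 - 1)%:E.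
by apply/cvg_EFin => //; near=> k.
Unshelve. all: by end_near. Qed.

End real_facts.

(** * Real-valued e-values and selection of convergent sequences *)

Section real_e_values.
Context d (X : measurableType d) (R : realType).
Variable H : set (probability X R).
Implicit Types f g h : X -> R.

Definition real_e_values : set (X -> R) :=
  [set f : X -> R | e_values H (EFin \o f)].

Lemma real_e_values_measurable f :
  real_e_values f -> measurable_fun [set: X] f.
Proof. by move=> [mf _ _]; exact/measurable_EFinP. Qed.

Lemma real_e_values_ge0 f : real_e_values f -> forall x, (0 <= f x)%R.
Proof. by move=> [_ f0 _] x; rewrite -lee_fin; exact: f0. Qed.

Lemma real_e_values1 : real_e_values (cst 1%R).
Proof.
split => [|x|P HP].
- by apply/measurable_EFinP; exact: measurable_cst.
- by rewrite /= lee_fin.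
- have -> : EFin \o cst (1%R : R) = cst 1 :> (X -> \bar R) by [].
  rewrite (integral_cst P measurableT) mul1e; exact: probability_le1.
Qed.

Lemma real_e_values_convex f g (t : R) : (0 <= t <= 1)%R ->
  real_e_values f -> real_e_values g ->
  real_e_values (fun x => t * f x + (1 - t) * g x)%R.
Proof.
move=> /andP[t0 t1] [mf f0 f1] [mg g0 g1].
have t1' : (0 <= 1 - t)%R by rewrite subr_ge0.
have mtf : measurable_fun [set: X] (fun x => (t * f x)%:E).
  by apply/measurable_EFinP; apply: measurable_funM => //; exact/measurable_EFinP.
have mtg : measurable_fun [set: X] (fun x => ((1 - t) * g x)%:E).
  by apply/measurable_EFinP; apply: measurable_funM => //; exact/measurable_EFinP.
split => /=.
- exact: emeasurable_funD mtf mtg.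
- by move=> x; rewrite lee_fin addr_ge0// mulr_ge0// -lee_fin; [exact: f0|exact: g0].
- move=> P HP; under eq_integral do rewrite EFinD.
  rewrite ge0_integralD//; last 2 first.
  + by move=> x _; rewrite lee_fin mulr_ge0// -lee_fin; exact: f0.
  + by move=> x _; rewrite lee_fin mulr_ge0// -lee_fin; exact: g0.
  under eq_integral do rewrite EFinM.
  under [X in _ + X]eq_integral do rewrite EFinM.
  rewrite !ge0_integralZl_EFin//; last 2 first.
  - by move=> x _; exact: g0.
  - by move=> x _; exact: f0.
  rewrite (_ : 1 = t%:E * 1 + (1 - t)%:E * 1); last first.
    by rewrite !mule1 -EFinD addrC subrK.
  by apply: leeD; apply: lee_wpmul2l; rewrite ?lee_fin//; [exact: f1|exact: g1].
Qed.

Lemma real_e_values_le f h : measurable_fun [set: X] h ->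
  (forall x, 0 <= h x <= f x)%R -> real_e_values f -> real_e_values h.
Proof.
move=> mh h0f [mf f0 f1]; split => /=; first exact/measurable_EFinP.
- by move=> x; rewrite lee_fin; case/andP: (h0f x).
- move=> P HP; apply: le_trans (f1 P HP); apply: ge0_le_integral => //.
  + by move=> x _; rewrite lee_fin; case/andP: (h0f x).
  + exact/measurable_EFinP.
  + by move=> x _; rewrite lee_fin; case/andP: (h0f x).
Qed.

Definition midpoint_closed (D : set (X -> R)) : Prop :=
  forall f g, D f -> D g -> D (fun x => (f x + g x) / 2)%R.

Lemma real_e_values_midpoint : midpoint_closed real_e_values.
Proof.
move=> f g Cf Cg.
rewrite (_ : (fun x => _) = fun x => (2^-1 * f x + (1 - 2^-1) * g x)%R).
  by apply: real_e_values_convex => //; lra.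
by apply/funext => x; field.
Qed.

Variable mu : {measure set X -> \bar R}.
Hypothesis mu_le1 : mu [set: X] <= 1.
Hypothesis mu_ac : forall N : set X, H_negligible H N -> mu N = 0.

(** Finiteness of each P-expectation makes the set where e is infinite
H-negligible. *)
Lemma e_values_ae_fin e : e_values H e ->
  {ae mu, forall x, e x = (fine (e x))%:E}.
Proof.
move=> [me e0 e1].
have mN : measurable (e @^-1` [set +oo]).
  by rewrite -[X in measurable X]setTI; exact: me.
exists (e @^-1` [set +oo]); split => //.
  apply: mu_ac; split => // P HP; apply/(negligibleP _ mN).
  have eP : P.-integrable [set: X] e.
    apply/integrableP; split => //; under eq_integral do rewrite gee0_abs//.
    by apply: le_lt_trans (e1 P HP) _; rewrite ltry.
  have [M [mM PM0 sM]] := integrable_ae measurableT eP.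
  exists M; split => // x ex; apply: sM => /(_ I).
  by rewrite /= in ex; rewrite ex.
move=> x /= h; apply: contrapT => ex; apply: h.
by rewrite fineK// ge0_fin_numE// ltey; exact/eqP.
Qed.

Lemma fine_e_values e : e_values H e -> real_e_values (fine \o e).
Proof.
move=> [me e0 e1].
have mf : measurable_fun [set: X] (EFin \o (fine \o e)).
  by apply/measurable_EFinP; apply: (measurableT_comp (fine_measurable _)).
split => //= [x|P HP]; first by rewrite lee_fin fine_ge0.
apply: le_trans (e1 P HP); apply: ge0_le_integral => //.
- by move=> x _; rewrite lee_fin fine_ge0.
- by move=> x _; case: (e x) (e0 x) => [r _|_|//] /=; rewrite ?leey.
Qed.

(** The lower limit is taken everywhere, and not only mu-almost everywhere, so
that Fatou applies under every P in H: mu-null sets need not be P-null. *)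
Lemma e_values_limn_einf (f : (X -> R)^nat) :
  (forall k, real_e_values (f k)) ->
  e_values H (fun x => limn_einf (fun k => (f k x)%:E)).
Proof.
move=> Cf.
have mf k : measurable_fun [set: X] (fun x => (f k x)%:E) by have [] := Cf k.
have f0 k x : 0 <= (f k x)%:E.
  by rewrite lee_fin; exact: (real_e_values_ge0 (Cf k)).
split; first exact: measurable_fun_limn_einf.
- by move=> x; exact: limn_einf_ge0.
- move=> P HP; apply: (fatou_le mf f0).
  + exact: measurable_fun_limn_einf.
  + by move=> x; exact: limn_einf_ge0.
  + by near=> x.
  + move=> k; have [_ _ /(_ P HP) fk] := Cf k; apply: (le_trans fk).
    by rewrite lee_fin lerDl invr_ge0.
Unshelve. all: by end_near. Qed.

(** The compactness statement behind both the numeraire and the optimum. Near-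
minimizers f_k and f_(k+1) of Phi lie in a common D_N together with their
midpoint, and strong convexity bounds the mean square of q f_k - q f_(k+1). *)
Lemma ae_cvg_selection (D : (set (X -> R))^nat) :
  (forall k, D k `<=` real_e_values) -> (forall k, D k !=set0) ->
  (forall m n, (m <= n)%N -> D n `<=` D m) ->
  (forall k, midpoint_closed (D k)) ->
  exists (f : (X -> R)^nat) (g : X -> R), [/\ forall k, D k (f k),
    real_e_values g & {ae mu, forall x, f k x @[k --> \oo] --> g x}].
Proof.
move=> DC D0 Ddec Dmid.
have CD k f : D k f -> real_e_values f by exact: DC.
(* The absolute value makes q positive for every f, without a side condition. *)
pose q f x : R := ((1 + `|f x|)^-1)%R.
have q0 f x : (0 < 1 + `|f x|)%R by rewrite ltr_pwDl.
have qE f x : real_e_values f -> q f x = ((1 + f x)^-1)%R.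
  by move=> Cf; rewrite /q ger0_norm// (real_e_values_ge0 Cf).
have mq f : real_e_values f -> measurable_fun [set: X] (fun x => q f x).
  move=> Cf; apply: measurable_fun_inv => [|x]; last by rewrite addr_ge0.
  apply: measurable_funD => //; apply: measurableT_comp => //.
  exact: real_e_values_measurable.
have q_ge0 f x : 0 <= (q f x)%:E by rewrite lee_fin invr_ge0 ltW.
pose Phi f : R := fine (\int[mu]_x (q f x)%:E).
have qfin f : real_e_values f ->
    0 <= \int[mu]_x (q f x)%:E <= 1 /\ \int[mu]_x (q f x)%:E = (Phi f)%:E.
  move=> Cf; have q1 : \int[mu]_x (q f x)%:E <= 1.
    apply: (@le_trans _ _ (\int[mu]_x (cst 1 x))).
      apply: ge0_le_integral => //; first by apply/measurable_EFinP; exact: mq.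
      by move=> x _; rewrite lee_fin invf_le1// lerDl.
    by rewrite integral_cst// mul1e.
  have q_0 : 0 <= \int[mu]_x (q f x)%:E by exact: integral_ge0.
  split; first by rewrite q_0.
  rewrite fineK// ge0_fin_numE//; apply: le_lt_trans q1 _; exact: ltry.
have q_conv f g : real_e_values f -> real_e_values g ->
    \int[mu]_x ((q f x - q g x) ^+ 2)%:E <=
    (2 * Phi f + 2 * Phi g - 4 * Phi (fun x => (f x + g x) / 2))%:E.
  move=> Cf Cg; have Cm := real_e_values_midpoint Cf Cg.
  have mk (k : R) h : real_e_values h ->
      measurable_fun [set: X] (fun x => (k * q h x)%:E).
    by move=> Ch; apply/measurable_EFinP; apply: measurable_funM => //; exact: mq.
  have ms : measurable_fun [set: X] (fun x => ((q f x - q g x) ^+ 2)%:E).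
    apply/measurable_EFinP; apply: measurable_funX.
    by apply: measurable_funB; exact: mq.
  have s0 x : [set: X] x -> 0 <= ((q f x - q g x) ^+ 2)%:E.
    by rewrite lee_fin sqr_ge0.
  have k0 (k : R) h x : (0 <= k)%R -> [set: X] x -> 0 <= (k * q h x)%:E.
    by move=> k_ge0 _; rewrite lee_fin mulr_ge0// -lee_fin.
  have kE (k : R) h : (0 <= k)%R -> real_e_values h ->
      \int[mu]_x (k * q h x)%:E = (k * Phi h)%:E.
    move=> k_ge0 Ch; under eq_integral do rewrite EFinM.
    rewrite ge0_integralZl_EFin//; last by apply/measurable_EFinP; exact: mq.
    by have [_ ->] := qfin h Ch; rewrite EFinM.
  rewrite EFinB leeBrDr// -kE// EFinD -(kE 2%R f)// -(kE 2%R g)//.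
  rewrite -!ge0_integralD//; try by move=> *; exact: k0.
  - apply: ge0_le_integral => //.
    + by move=> x _; rewrite adde_ge0 ?s0 ?k0.
    + by apply: emeasurable_funD => //; exact: mk.
    + by apply: emeasurable_funD; exact: mk.
    + move=> x _; rewrite -!EFinD lee_fin !qE//.
      by apply: inv1D_midpoint; exact: real_e_values_ge0.
  - exact: mk.
  - exact: mk.
  - exact: mk.
have [i near_i] : exists i : R, forall k e, (0 < e)%R -> exists N f,
    [/\ (k <= N)%N, D N f, (Phi f <= i + e)%R &
        forall h, D N h -> (i - e <= Phi h)%R].
  apply: near_minimizers => // k h /CD Ch.
  by have [+ hE] := qfin h Ch; rewrite hE !lee_fin.
pose e k : R := ((2 ^ k.+1)%:R^-1)%R.
have e0 k : (0 < e k)%R by rewrite invr_gt0 ltr0n expn_gt0.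
have /choice[N /choice[f Nf]] : forall k, exists N f,
    [/\ (k <= N)%N, D N f, (Phi f <= i + e k ^+ 2 / 8)%R &
        forall h, D N h -> (i - e k ^+ 2 / 8 <= Phi h)%R].
  by move=> k; apply: near_i; rewrite divr_gt0// exprn_gt0.
have Cf k : real_e_values (f k) by have [_ /CD] := Nf k.
have q_cvg : {ae mu, forall x, cvgn (fun k => q (f k) x)}.
  apply: ae_cvg_fast_cauchy => // [k|k]; first exact: mq.
  apply: le_trans (q_conv _ _ (Cf k) (Cf k.+1)) _; rewrite lee_fin -/(e k).
  have [_ Dk fk ik] := Nf k; have [_ Dk1 fk1 ik1] := Nf k.+1.
  have ee : (e k.+1 ^+ 2 <= e k ^+ 2)%R.
    rewrite lerXn2r ?nnegrE ?(ltW (e0 _))// lef_pV2 ?posrE ?ltr0n ?expn_gt0//.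
    by rewrite ler_nat leq_exp2l.
  (* The midpoint lies in the larger of the two sets D (N k), D (N k.+1). *)
  have : (i - e k ^+ 2 / 8 <= Phi (fun x => (f k x + f k.+1 x) / 2))%R.
    have [NN|/ltnW NN] := leqP (N k) (N k.+1).
      by apply: ik; apply: Dmid => //; exact: Ddec NN _ Dk1.
    apply: le_trans (ik1 _ _); first by lra.
    by apply: Dmid => //; exact: Ddec NN _ Dk.
  lra.
have CG := e_values_limn_einf Cf; have Gfin := e_values_ae_fin CG.
exists f, (fine \o (fun x => limn_einf (fun k => (f k x)%:E))); split.
- by move=> k; have [kN Dk _ _] := Nf k; exact: Ddec kN _ Dk.
- exact: fine_e_values.
- apply: filterS2 q_cvg Gfin => x qx Gx.
  apply: cvg_of_cvg_inv1D.
  + by move=> k; exact: real_e_values_ge0.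
  + by under eq_fun do rewrite -qE//.
  + by rewrite [X in X < _]Gx ltry.
Qed.

End real_e_values.

(** * An approximate numeraire *)

Section numeraire.
Context d (X : measurableType d) (R : realType).
Variable H : set (probability X R).
Implicit Types f g h : X -> R.
Variable mu : {measure set X -> \bar R}.
Hypothesis mu_le1 : mu [set: X] <= 1.
Hypothesis mu_ac : forall N : set X, H_negligible H N -> mu N = 0.

Local Notation C := (real_e_values H).

(** First-order expansion of ln at y in the direction z with an explicit error.
It follows from ln s <= s - 1 at s = y/h, where h is the perturbed point, after
replacing the denominator h by y at the cost of t^2 (z-y)^2 / (y h), where
1/(y h) <= 4. The factor 2 inside ln makes both logarithms nonnegative, so that
they can be integrated without integrability conditions. *)
Lemma ln2_first_order (b t y z : R) : (0 < t <= 1)%R ->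
  (2^-1 <= y <= b)%R -> (2^-1 <= z <= b)%R ->
  (ln (2 * y) + t * (z / y)
   <= ln (2 * (t * z + (1 - t) * y)) + (t + t ^+ 2 * (4 * b ^+ 2)))%R.
Proof.
move=> /andP[t0 t1] /andP[y2 yb] /andP[z2 zb].
set h := (t * z + (1 - t) * y)%R.
have y0 : (0 < y)%R by lra.
have z0 : (0 < z)%R by lra.
have h2 : (2^-1 <= h)%R by rewrite /h; nra.
have h0 : (0 < h)%R by lra.
have lnyh : (ln (2 * y) <= ln (2 * h) + (y / h - 1))%R.
  rewrite -lerBlDl -ln_div ?posrE ?mulr_gt0//.
  rewrite (_ : 2 * y / (2 * h) = 1 + (y / h - 1))%R; last by field; rewrite gt_eqF.
  by apply: le_ln1Dx; rewrite ltrBrDr addrC subrr divr_gt0.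
have yh4 : (4^-1 <= y * h)%R by nra.
have zy : ((z - y) ^+ 2 <= b ^+ 2)%R by nra.
have E : (t * (z / y) + (y / h - 1) - t = t ^+ 2 * ((z - y) ^+ 2 / (y * h)))%R.
  by rewrite /h; field; rewrite -/h !gt_eqF.
have F : ((z - y) ^+ 2 / (y * h) <= 4 * b ^+ 2)%R.
  rewrite ler_pdivrMr ?mulr_gt0//; nra.
have G : (t ^+ 2 * ((z - y) ^+ 2 / (y * h)) <= t ^+ 2 * (4 * b ^+ 2))%R.
  by rewrite ler_wpM2l// sqr_ge0.
lra.
Qed.

Lemma measurable_fun_div f g : measurable_fun [set: X] f ->
  measurable_fun [set: X] g -> (forall x, 0 <= g x)%R ->
  measurable_fun [set: X] (fun x => (f x / g x)%:E).
Proof.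
move=> mf mg g0; apply/measurable_EFinP; apply: measurable_funM => //.
exact: measurable_fun_inv.
Qed.

(** A near-maximizer of the expected logarithm suffices: perturbing it towards g
by a step t gives t E[g/f] <= t/2 + t + 4 t^2 b^2, and t = 1/(8 b^2) gives the
bound 2. *)
Lemma near_log_optimal (b : R) : (1 <= b)%R -> exists f,
  [/\ C f, forall x, (2^-1 <= f x)%R &
      forall g, C g -> (forall x, 2^-1 <= g x <= b)%R ->
        \int[mu]_x (g x / f x)%:E <= 2%:E].
Proof.
move=> b1.
pose D := [set f | C f /\ forall x, (2^-1 <= f x <= b)%R].
pose L f := \int[mu]_x (ln (2 * f x))%:E.
have Df_gt0 f x : D f -> (0 < f x)%R.
  by move=> [_ /(_ x) /andP[+ _]]; apply: lt_le_trans; rewrite invr_gt0.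
have ml f : D f -> measurable_fun [set: X] (fun x => (ln (2 * f x))%:E).
  move=> [Cf _]; apply/measurable_EFinP; apply: (@measurableT_comp _ _ _ _ _ _ (@ln R)).
    exact: measurable_ln.
  by apply: measurable_funM => //; exact: real_e_values_measurable Cf.
have ln0 f x : D f -> 0 <= (ln (2 * f x))%:E.
  by move=> [_ /(_ x) /andP[f2 _]]; rewrite lee_fin ln_ge0//; lra.
have Lb f : D f -> 0 <= L f <= (ln (2 * b))%:E.
  move=> Df; rewrite integral_ge0/=; last by move=> x _; exact: ln0.
  apply: (@le_trans _ _ (\int[mu]_x (cst (ln (2 * b))%:E x))).
    apply: ge0_le_integral => //.
    - by move=> x _; exact: ln0.
    - exact: ml.
    - move=> x _; have := Df_gt0 _ x Df; case: Df => _ /(_ x) /andP[_ fb] f0.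
      by rewrite lee_fin ler_ln ?posrE ?mulr_gt0 ?ler_pM2l//; lra.
  rewrite integral_cst// -[leRHS]mule1 lee_wpmul2l// lee_fin ln_ge0//; lra.
have Lfin f : D f -> L f = (fine (L f))%:E.
  move=> /Lb/andP[L0 L1]; rewrite fineK// ge0_fin_numE//.
  by apply: le_lt_trans L1 _; rewrite ltry.
have D1 : D (cst 1%R) by split; [exact: real_e_values1|move=> x /=; lra].
have hs : has_sup [set fine (L f) | f in D].
  split; first by exists (fine (L (cst 1%R))); exists (cst 1%R).
  exists (ln (2 * b)) => _ [f Df <-]; have := Lb f Df.
  by rewrite {1 2}Lfin// !lee_fin => /andP[].
pose t := ((8 * b ^+ 2)^-1)%R.
have b2 : (1 <= b ^+ 2)%R by rewrite exprn_ege1.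
have t0 : (0 < t)%R by rewrite invr_gt0; lra.
have t1 : (t <= 1)%R by rewrite invf_le1; lra.
have tb : (t * (8 * b ^+ 2) = 1)%R by rewrite mulVf//; lra.
have [_ [f Df <-] fsup] := sup_adherent (divr_gt0 t0 (ltr0Sn _ 1)) hs.
exists f; split; [by case: Df|by move=> x; case: Df => _ /(_ x) /andP[]|].
move=> g Cg g2b; pose h x := (t * g x + (1 - t) * f x)%R.
have t01 : (0 < t <= 1)%R by rewrite t0.
have Dh : D h.
  split; first by apply: real_e_values_convex => //; [rewrite ltW|case: Df].
  move=> x; rewrite /h; case: Df => _ /(_ x); move: (g2b x).
  by move=> /andP[? ?] /andP[? ?]; apply/andP; split; nra.
have hsup : (fine (L h) <= sup [set fine (L f) | f in D])%R.
  by apply: sup_upper_bound => //; exists h.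
have mgf : measurable_fun [set: X] (fun x => (g x / f x)%:E).
  apply: measurable_fun_div => //; first exact: real_e_values_measurable Cg.
    by case: Df => Cf _; exact: real_e_values_measurable Cf.
  by move=> x; rewrite ltW// Df_gt0.
have gf0 x : [set: X] x -> 0 <= (g x / f x)%:E.
  by move=> _; rewrite lee_fin divr_ge0 ?(ltW (Df_gt0 _ x Df))//;
    case/andP: (g2b x) => ? _; lra.
have key : L f + t%:E * \int[mu]_x (g x / f x)%:E
           <= L h + (t + t ^+ 2 * (4 * b ^+ 2))%:E.
  have c0 : (0 <= t + t ^+ 2 * (4 * b ^+ 2))%R.
    by rewrite addr_ge0 ?(ltW t0)// mulr_ge0 ?sqr_ge0// mulr_ge0 ?sqr_ge0.
  apply: (@le_trans _ _ (L h + \int[mu]_x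
      (cst (t + t ^+ 2 * (4 * b ^+ 2))%:E x))); last first.
    by rewrite leeD2l// integral_cst// -[leRHS]mule1 lee_wpmul2l// lee_fin.
  rewrite -ge0_integralZl_EFin ?(ltW t0)//.
  rewrite -!ge0_integralD//; try (by first [exact: ml|move=> x _; exact: ln0]).
  - apply: ge0_le_integral => //.
    + by move=> x _; rewrite adde_ge0 ?ln0// -EFinM lee_fin mulr_ge0 ?(ltW t0)// -lee_fin gf0.
    + apply: emeasurable_funD; first exact: ml.
      by apply: emeasurable_funM => //.
    + by apply: emeasurable_funD => //; exact: ml.
    + move=> x _; rewrite -EFinM -!EFinD lee_fin; apply: ln2_first_order => //.
      by case: Df.
  - by move=> x _; rewrite -EFinM lee_fin mulr_ge0 ?(ltW t0)// -lee_fin gf0.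
  - by apply: emeasurable_funM => //.
move: key; rewrite (Lfin f Df) (Lfin h Dh) => key.
have : (fine (L f))%:E + t%:E * \int[mu]_x (g x / f x)%:E
       <= (fine (L f))%:E + t%:E * 2%:E.
  apply: (le_trans key); rewrite -EFinM -!EFinD lee_fin.
  have -> : (t ^+ 2 * (4 * b ^+ 2) = t / 2)%R.
    have : (t * (t * (8 * b ^+ 2)) = t)%R by rewrite tb mulr1.
    by move: (t) => u; lra.
  lra.
by rewrite leeD2lE// lee_pmul2l.
Qed.

(** The average of 1 and the truncation of g at n takes its values in
[1/2, n+1], so near log-optimality applies to it; it dominates half of the
truncation, which doubles the bound. *)
Lemma near_numeraire (n : nat) : exists f,
  [/\ C f, forall x, (2^-1 <= f x)%R &
      forall g, C g -> \int[mu]_x (Num.min (g x) n%:R / f x)%:E <= 4%:E].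
Proof.
have b1 : (1 <= n.+1%:R :> R)%R by rewrite ler1n.
have [f [Cf f2 fopt]] := near_log_optimal b1.
exists f; split => // g Cg.
have mg := real_e_values_measurable Cg; have g0 := real_e_values_ge0 Cg.
have f0 x : (0 < f x)%R by apply: lt_le_trans (f2 x); rewrite invr_gt0.
pose m x : R := Num.min (g x) n%:R.
have mm : measurable_fun [set: X] m by exact: measurable_minr.
have m0 x : (0 <= m x)%R by rewrite le_min g0 ler0n.
have Cm : C m by apply: (real_e_values_le mm) Cg => x; rewrite m0 ge_min lexx.
have Cm' := real_e_values_midpoint Cm (real_e_values1 H).
have mmf : measurable_fun [set: X] (fun x => ((m x + cst 1 x) / 2 / f x)%:E).
  apply: measurable_fun_div; [exact: real_e_values_measurable Cm'| |].
    exact: real_e_values_measurable Cf.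
  by move=> x; exact: ltW.
apply: (@le_trans _ _ (\int[mu]_x (2%:E * ((m x + cst 1 x) / 2 / f x)%:E))).
  apply: ge0_le_integral => //.
  - by move=> x _; rewrite lee_fin; exact: divr_ge0 (m0 x) (ltW (f0 x)).
  - apply: measurable_fun_div => //; first exact: real_e_values_measurable Cf.
    by move=> x; exact: ltW.
  - exact: emeasurable_funM.
  - move=> x _; rewrite -EFinM lee_fin mulrA ler_wpM2r ?invr_ge0 ?(ltW (f0 x))//.
    by rewrite mulrC divfK// lerDl.
rewrite ge0_integralZl_EFin//; last first.
  by move=> x _; rewrite lee_fin !divr_ge0 ?addr_ge0// ltW.
rewrite (_ : 4%:E = 2%:E * 2%:E); last by rewrite -EFinM; congr (_%:E); ring.
apply: lee_wpmul2l => //; apply: fopt => // x /=.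
have : (m x <= n%:R)%R by rewrite ge_min lexx orbT.
rewrite -(natr1 n); have := m0 x; have := ler0n R n; move: (m x) => ? ? ? ?.
by apply/andP; split; lra.
Qed.

(** The maximum with 1 keeps the denominators positive on the null set where z
may vanish, and is where the growth condition on the utility applies. *)
Lemma numeraire_exists : exists z,
  [/\ C z, {ae mu, forall x, (2^-1 <= z x)%R} &
      forall g, C g -> \int[mu]_x (g x / Num.max (z x) 1)%:E <= 4%:E].
Proof.
pose D k := [set f | [/\ C f, forall x, (2^-1 <= f x)%R &
  forall g, C g -> \int[mu]_x (Num.min (g x) k%:R / f x)%:E <= 4%:E]].
have D_gt0 k f x : D k f -> (0 < f x)%R.
  by move=> [_ /(_ x) + _]; apply: lt_le_trans; rewrite invr_gt0.
have mD k j f g : D k f -> C g ->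
    measurable_fun [set: X] (fun x => (Num.min (g x) j%:R / f x)%:E).
  move=> Df Cg; apply: measurable_fun_div.
  - by apply: measurable_minr => //; exact: real_e_values_measurable Cg.
  - by case: Df => Cf _ _; exact: real_e_values_measurable Cf.
  - by move=> x; exact/ltW/D_gt0/Df.
have min0 (j : nat) g x : C g -> (0 <= Num.min (g x) j%:R)%R.
  by move=> Cg; rewrite le_min (real_e_values_ge0 Cg)/=.
have minf0 k j f g x : D k f -> C g -> 0 <= (Num.min (g x) j%:R / f x)%:E.
  by move=> Df Cg; rewrite lee_fin divr_ge0 ?min0// ltW// (D_gt0 _ _ _ Df).
(* By convexity of the inverse; the defect is an explicit square. *)
have Dmid k : midpoint_closed (D k).
  move=> f g Df Dg; have [Cf f2 fopt] := Df; have [Cg g2 gopt] := Dg.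
  split; first exact: real_e_values_midpoint.
    by move=> x; have := f2 x; have := g2 x; lra.
  move=> h Ch; pose m x : R := Num.min (h x) k%:R.
  have Zm f' : D k f' ->
      measurable_fun [set: X] (fun x => (2^-1)%:E * (m x / f' x)%:E).
    by move=> Df'; apply: emeasurable_funM => //; exact: (mD k).
  have Z0 f' x : D k f' -> 0 <= (2^-1)%:E * (m x / f' x)%:E.
    by move=> Df'; rewrite mule_ge0 ?lee_fin ?invr_ge0// -lee_fin (minf0 k).
  apply: (@le_trans _ _ (\int[mu]_x ((2^-1)%:E * (m x / f x)%:E +
      (2^-1)%:E * (m x / g x)%:E))).
    apply: ge0_le_integral => //.
    - move=> x _; rewrite lee_fin divr_ge0 ?min0// divr_ge0// addr_ge0// ltW//.
        exact: D_gt0 Df.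
      exact: D_gt0 Dg.
    - apply: measurable_fun_div.
      + by apply: measurable_minr => //; exact: real_e_values_measurable Ch.
      + by apply: real_e_values_measurable; exact: real_e_values_midpoint Cf Cg.
      + by move=> x; rewrite divr_ge0// addr_ge0// ltW// (D_gt0 k).
    - by apply: emeasurable_funD; exact: Zm.
    - move=> x _; rewrite -!EFinM -EFinD lee_fin -/(m x).
      have fx := D_gt0 _ _ x Df; have gx := D_gt0 _ _ x Dg.
      have mx : (0 <= m x)%R by exact: min0.
      rewrite -subr_ge0 (_ : _ - _ =
        m x * (f x - g x) ^+ 2 / (2 * f x * g x * (f x + g x)))%R.
        rewrite divr_ge0 ?(mulr_ge0 mx (sqr_ge0 _))// ltW//.
        by rewrite !mulr_gt0// addr_gt0.
      by field; rewrite !gt_eqF ?addr_gt0.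
  rewrite ge0_integralD//; [|by move=> x _; exact: Z0|exact: Zm|
    by move=> x _; exact: Z0|exact: Zm].
  rewrite !ge0_integralZl_EFin ?invr_ge0//; [|by move=> x _; exact: (minf0 k)|
    exact: (mD k)|by move=> x _; exact: (minf0 k)|exact: (mD k)].
  rewrite (_ : 4%:E = (2^-1)%:E * 4%:E + (2^-1)%:E * 4%:E); last first.
    by rewrite -!EFinM -EFinD; congr (_%:E); field.
  by apply: leeD; apply: lee_wpmul2l; rewrite ?lee_fin ?invr_ge0//;
    [exact: fopt|exact: gopt].
have [f [z [Df Cz fz]]] : exists (f : (X -> R)^nat) z, [/\ forall k, D k (f k),
    C z & {ae mu, forall x, f k x @[k --> \oo] --> z x}].
  apply: ae_cvg_selection => //.
  - by move=> k f [].
  - by move=> k; have [f Df] := near_numeraire k; exists f.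
  - move=> m n mn f Df; have [Cf f2 fopt] := Df; split => // g Cg.
    apply: le_trans (fopt g Cg); apply: ge0_le_integral => //.
    + by move=> x _; exact: minf0 Df Cg.
    + exact: mD Df Cg.
    + exact: mD Df Cg.
    + move=> x _; rewrite lee_fin ler_wpM2r ?invr_ge0 ?(ltW (D_gt0 _ _ x Df))//.
      rewrite le_min !ge_min lexx/=; apply/orP; right; rewrite ler_nat//.
exists z; split => //.
  apply: filterS fz => x fxz; apply: (cvgr_to_ge fxz).
  by near=> k; have [_ + _] := Df k; exact.
move=> g Cg; have mg := real_e_values_measurable Cg.
have g0 := real_e_values_ge0 Cg.
have max_gt0 (y : R) : (0 < Num.max y 1)%R by rewrite lt_max ltr01 orbT.
have m_max h : C h -> measurable_fun [set: X] (fun x => Num.max (h x) 1%R).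
  by move=> Ch; apply: measurable_maxr => //; exact: real_e_values_measurable Ch.
have mgk k : measurable_fun [set: X]
    (fun x => (Num.min (g x) k%:R / Num.max (f k x) 1)%:E).
  apply: measurable_fun_div; first exact: measurable_minr.
    by apply: m_max; case: (Df k).
  by move=> x; exact: ltW.
have gk0 k x : 0 <= (Num.min (g x) k%:R / Num.max (f k x) 1)%:E.
  by rewrite lee_fin divr_ge0 ?min0// ltW.
apply: (fatou_le mgk gk0).
- by apply: measurable_fun_div => //; [exact: m_max|move=> x; exact: ltW].
- by move=> x; rewrite lee_fin divr_ge0// ltW.
- apply: filterS fz => x fxz.
  have /cvg_limn_einf_sup[-> _] // :
    (Num.min (g x) k%:R / Num.max (f k x) 1)%:E @[k --> \oo] -->
    (g x / Num.max (z x) 1)%:E.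
  apply/cvg_EFin; first by near=> k.
  apply: cvgM.
    apply: cvg_near_cst; near=> k; apply/min_idPl.
    by near: k; exact: nbhs_infty_ger.
  apply: cvgV; first by rewrite gt_eqF.
  have max_cont : {for z x, continuous (fun y : R => Num.max y 1%R)}.
    by apply: continuous_max; [exact: cvg_id|exact: cvg_cst].
  exact: cvg_comp fxz max_cont.
- move=> k; apply: (@le_trans _ _ 4%:E); last by rewrite lee_fin lerDl invr_ge0.
  have [_ _ fopt] := Df k; apply: le_trans (fopt g Cg).
  apply: ge0_le_integral => //; first exact: mD (Df k) Cg.
  move=> x _; rewrite lee_fin ler_wpM2l ?min0// lef_pV2 ?posrE ?max_gt0//.
    by rewrite le_max lexx.
  exact: D_gt0 (Df k).
Unshelve. all: by end_near. Qed.

End numeraire.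

(** * Maximizing the expected gain over a reference *)

Section integral_bounds.
Context d (X : measurableType d) (R : realType).
Variable mu : {measure set X -> \bar R}.
Implicit Types F G : X -> \bar R.

(** Monotonicity in full generality: the integral is the difference of the
integrals of the positive and negative parts, and subtraction of extended reals
is monotone whatever value oo - oo is given. *)
Lemma le_integral_pointwise F G :
  measurable_fun [set: X] F -> measurable_fun [set: X] G ->
  (forall x, F x <= G x) -> \int[mu]_x F x <= \int[mu]_x G x.
Proof.
move=> mF mG FG; rewrite integralE [leRHS]integralE; apply: leeB.
- apply: ge0_le_integral => //; try exact: measurable_funepos.
  by move=> x _; apply: funepos_le (in_setT x) => y _.
- apply: ge0_le_integral => //; try exact: measurable_funeneg.
  by move=> x _; apply: funeneg_le (in_setT x) => y _.
Qed.

Lemma integrable_of_integral_gtNy F : measurable_fun [set: X] F ->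
  \int[mu]_x F^\+ x < +oo -> -oo < \int[mu]_x F x ->
  mu.-integrable [set: X] F.
Proof.
move=> mF Fpos; rewrite integralE => Fint.
have p0 : 0 <= \int[mu]_x F^\+ x by exact: integral_ge0.
have n0 : 0 <= \int[mu]_x F^\- x by exact: integral_ge0.
apply/integrableP; split => //.
under eq_integral do rewrite -/((abse \o F) _) fune_abse.
rewrite ge0_integralD//; try exact: measurable_funepos;
  try exact: measurable_funeneg.
have pfin : \int[mu]_x F^\+ x \is a fin_num by rewrite ge0_fin_numE.
rewrite lte_add_pinfty// ltey; apply/eqP => Fy.
by move: Fint; rewrite Fy -(fineK pfin).
Qed.

End integral_bounds.

Section optimum.
Context d (X : measurableType d) (R : realType).
Variable H : set (probability X R).
Implicit Types f g h : X -> R.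
Variable mu : {measure set X -> \bar R}.
Hypothesis mu_le1 : mu [set: X] <= 1.
Hypothesis mu_ac : forall N : set X, H_negligible H N -> mu N = 0.

Local Notation C := (real_e_values H).

Variable V : R -> \bar R.
Hypothesis mV : forall f, measurable_fun [set: X] f -> (forall x, 0 <= f x)%R ->
  measurable_fun [set: X] (V \o f).
Hypothesis V_concave : concave_on [set y : R | (0 <= y)%R] V.
Hypothesis V_usc : upper_semicontinuous_on [set y : R | (0 <= y)%R] V.

Variables (v w : X -> R).
Hypothesis mv : measurable_fun [set: X] v.
Hypothesis mw : measurable_fun [set: X] w.
Hypothesis w_gt0 : forall x, (0 < w x)%R.
Hypothesis int_w : forall f, C f -> \int[mu]_x (f x / w x)%:E <= 4%:E.
Hypothesis V_sublinear : forall eta : R, (0 < eta)%R ->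
  exists2 a : R, (0 <= a)%R &
    forall x y, (0 <= y)%R -> V y - (v x)%:E <= (a + eta * (y / w x))%:E.

(** Expected utilities may be infinite; differences with the reference v have
controlled positive parts, so their integrals can be maximized. *)
Definition gain f x : \bar R := V (f x) - (v x)%:E.

Lemma measurable_gain f : C f -> measurable_fun [set: X] (gain f).
Proof.
move=> Cf; apply: emeasurable_funB; last exact/measurable_EFinP.
by apply: mV; [exact: real_e_values_measurable Cf|exact: real_e_values_ge0 Cf].
Qed.

Lemma integrable_cst_le1 (a : R) : mu.-integrable [set: X] (cst a%:E).
Proof.
apply/integrableP; split; first exact: measurable_cst.
rewrite (_ : (fun x => _) = cst `|a|%:E)//.
rewrite integral_cst//; apply: (@le_lt_trans _ _ (`|a|%:E * 1)).
  by rewrite lee_wpmul2l.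
by rewrite mule1 ltry.
Qed.

Lemma sublinear_utility_lty y : X -> (0 <= y)%R -> V y < +oo.
Proof.
move=> x y0; have [a _ /(_ x y y0)] := V_sublinear ltr01.
by case: (V y) => // r; rewrite ltry.
Qed.

Lemma integrable_sublinear_bound f (a eta : R) : (0 <= eta)%R -> C f ->
  mu.-integrable [set: X] (fun x => (a + eta * (f x / w x))%:E).
Proof.
move=> eta0 Cf.
have mfw : measurable_fun [set: X] (fun x => (f x / w x)%:E).
  apply: measurable_fun_div => //; first exact: real_e_values_measurable Cf.
  by move=> x; exact: ltW.
have ifw : mu.-integrable [set: X] (fun x => (f x / w x)%:E).
  apply/integrableP; split => //.
  under eq_integral do rewrite gee0_abs ?lee_fin ?divr_ge0
    ?(real_e_values_ge0 Cf) ?(ltW (w_gt0 _))//.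
  by apply: le_lt_trans (int_w Cf) _; rewrite ltry.
rewrite (_ : (fun x => _) = (fun x => a%:E + eta%:E * (f x / w x)%:E)); last first.
  by apply/funext => x; rewrite -EFinM -EFinD.
apply: integrableD => //; [exact: integrable_cst_le1|exact: integrableZl].
Qed.

Lemma integral_gain_lty f : C f -> \int[mu]_x (gain f)^\+ x < +oo.
Proof.
move=> Cf; have [a a0 Va] := V_sublinear ltr01.
have /integrableP[mB] := integrable_sublinear_bound a ler01 Cf.
apply: le_lt_trans; apply: ge0_le_integral => //.
- exact/measurable_funepos/measurable_gain.
- exact: (@measurableT_comp _ _ _ _ _ _ abse).
- move=> x _; have fx := real_e_values_ge0 Cf x.
  rewrite gee0_abs; last first.
    by rewrite lee_fin mul1r addr_ge0// divr_ge0// ltW.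
  rewrite funepos.unlock ge_max Va// lee_fin mul1r addr_ge0// divr_ge0// ltW//.
Qed.

Lemma integrable_gain f : C f -> -oo < \int[mu]_x gain f x ->
  mu.-integrable [set: X] (gain f).
Proof.
move=> Cf; apply: integrable_of_integral_gtNy; first exact: measurable_gain.
exact: integral_gain_lty.
Qed.

Lemma gain_midpoint f g x : C f -> C g ->
  (2^-1)%:E * gain f x + (2^-1)%:E * gain g x
  <= gain (fun x => (f x + g x) / 2)%R x.
Proof.
move=> Cf Cg; have f0 := real_e_values_ge0 Cf x; have g0 := real_e_values_ge0 Cg x.
have t01 : (0 < (2^-1 : R) < 1)%R by lra.
have := @V_concave _ _ _ f0 g0 t01.
have := sublinear_utility_lty x f0; have := sublinear_utility_lty x g0.
rewrite (_ : 2^-1 * f x + (1 - 2^-1) * g x = (f x + g x) / 2)%R; last by field.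
rewrite (_ : 1 - 2^-1 = 2^-1 :> R)%R; last by field.
have f2 : (0 < (2^-1)%:E :> \bar R) by rewrite lte_fin.
rewrite /gain; case: (V (f x)) => [r| |] // ; case: (V (g x)) => [s| |] // _ _.
- move=> rs; rewrite -!EFinB -!EFinM -EFinD.
  rewrite (_ : _ + _ = (2^-1 * r + 2^-1 * s) - v x)%R; last by field.
  by rewrite EFinB; apply: leeB => //; exact: rs.
- by move=> _; rewrite addNye gt0_muleNy// addeNy leNye.
- by move=> _; rewrite addNye gt0_muleNy// addNye leNye.
- by move=> _; rewrite addNye gt0_muleNy// addNye leNye.
Qed.

(** Upper semicontinuity of V, as lower semicontinuity of the nonnegative slack in
the sublinear bound, which is the form needed for Fatou. *)
Lemma le_limn_einf_gain (u : R^nat) (y a eta : R) x : (0 <= y)%R ->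
  (forall k, 0 <= u k)%R -> u k @[k --> \oo] --> y ->
  (a + eta * (y / w x))%:E - (V y - (v x)%:E) <=
  limn_einf (fun k => (a + eta * (u k / w x))%:E - (V (u k) - (v x)%:E)).
Proof.
move=> y0 u0 uy; apply: limn_einf_ge => b.
set r : R := (a + eta * (y / w x))%R => br.
(* A real q strictly between V y and the bound, also when V y = -oo. *)
have [q Vq qr] : exists2 q : R, V y < q%:E & (q < r + v x - b)%R.
  move: br; have := sublinear_utility_lty x y0; case: (V y) => [s| |] // _.
    rewrite -!EFinB lte_fin => br; exists ((s + (r + v x - b)) / 2)%R.
      by rewrite lte_fin; lra.
    by lra.
  by move=> _; exists (r + v x - b - 1)%R; [rewrite ltNyr|lra].
have Vu : \forall k \near \oo, V (u k) < q%:E.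
  have : \forall k \near \oo, (0 <= u k)%R -> V (u k) < q%:E.
    exact: uy _ (@V_usc _ _ y0 Vq).
  by apply: filterS => k; exact.
have ru : (a + eta * (u k / w x))%R @[k --> \oo] --> r.
  apply: cvgD; first exact: cvg_cst.
  by apply: cvgM; [exact: cvg_cst|apply: cvgM => //; exact: cvg_cst].
have bq : \forall k \near \oo, (b + q - v x < a + eta * (u k / w x))%R.
  have bq0 : (b + q - v x < r)%R by lra.
  exact: (@cvgr_gt _ _ _ _ _ r ru _ bq0).
near=> k; have : V (u k) < q%:E by near: k.
have : (b + q - v x < a + eta * (u k / w x))%R.
  by near: k.
case: (V (u k)) => [s| |] // h; last by move=> _; rewrite addNye/= addey// leey.
by rewrite -!EFinB lte_fin lee_fin; lra.
Unshelve. all: by end_near. Qed.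

(** Fatou applied to the slack a + eta * f/w - gain f along a maximizing sequence
loses at most 4 eta, for every eta > 0, so the limit attains the supremum. *)
Lemma exists_optimum : (exists2 z, C z & -oo < \int[mu]_x gain z x) ->
  exists g, [/\ C g, mu.-integrable [set: X] (gain g) &
    forall f, C f -> \int[mu]_x gain f x <= \int[mu]_x gain g x].
Proof.
move=> [z Cz Jz].
pose J f := \int[mu]_x gain f x.
have J_le f (a eta : R) : (0 < eta)%R -> C f ->
    (forall x y, (0 <= y)%R -> V y - (v x)%:E <= (a + eta * (y / w x))%:E) ->
    J f <= \int[mu]_x (a + eta * (f x / w x))%:E.
  move=> eta0 Cf Va; apply: le_integral_pointwise; first exact: measurable_gain.
    by have /integrableP[] := integrable_sublinear_bound a (ltW eta0) Cf.
  by move=> x; apply: Va; exact: real_e_values_ge0 Cf x.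
have int_B f (a eta : R) : (0 < eta)%R -> C f ->
    \int[mu]_x (cst a%:E x) <= \int[mu]_x (a + eta * (f x / w x))%:E
     <= \int[mu]_x (cst a%:E x) + (eta * 4)%:E.
  move=> eta0 Cf.
  have fw0 x : (0 <= f x / w x)%R.
    by rewrite divr_ge0 ?(real_e_values_ge0 Cf)// ltW.
  have mfw : measurable_fun [set: X] (fun x => (f x / w x)%:E).
    apply: measurable_fun_div => //; first exact: real_e_values_measurable Cf.
    by move=> x; exact: ltW.
  have ietafw : mu.-integrable [set: X] (fun x => (eta * (f x / w x))%:E).
    rewrite (_ : (fun x => _) = fun x => (0 + eta * (f x / w x))%:E).
      exact: integrable_sublinear_bound (ltW eta0) Cf.
    by apply/funext => x; rewrite add0r.
  have -> : \int[mu]_x (a + eta * (f x / w x))%:E =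
      \int[mu]_x (cst a%:E x) + eta%:E * \int[mu]_x (f x / w x)%:E.
    under eq_integral do rewrite EFinD.
    rewrite integralD//; last exact: integrable_cst_le1.
    congr (_ + _); under eq_integral do rewrite EFinM.
    by rewrite ge0_integralZl_EFin ?(ltW eta0)// => x _; rewrite lee_fin.
  apply/andP; split.
    rewrite leeDl// mule_ge0 ?lee_fin ?(ltW eta0)//.
    by apply: integral_ge0 => x _; rewrite lee_fin.
  by rewrite leeD2l// EFinM lee_pmul2l ?lte_fin//; exact: int_w.
have int_cst (a : R) : \int[mu]_x (cst a%:E x) \is a fin_num.
  by apply: integrable_fin_num => //; exact: integrable_cst_le1.
pose s := ereal_sup (J @` C).
have s_fin : s \is a fin_num.
  rewrite fin_numE -ltNye -ltey; apply/andP; split.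
    by apply: lt_le_trans Jz _; apply: ereal_sup_ubound; exists z.
  have [a _ Va] := V_sublinear ltr01.
  apply: (@le_lt_trans _ _ (\int[mu]_x (cst a%:E x) + (1 * 4)%:E)).
    apply: ge_ereal_sup => _ [f Cf <-]; apply: le_trans (J_le f a 1%R ltr01 Cf Va) _.
    by have /andP[] := int_B f a 1%R ltr01 Cf.
  by rewrite -(fineK (int_cst a)) -EFinD ltry.
pose S := fine s; have sE : s = S%:E by rewrite fineK.
have J_S f : C f -> J f <= S%:E.
  by move=> Cf; rewrite -sE; apply: ereal_sup_ubound; exists f.
pose D k := [set f | C f /\ (S - k.+1%:R^-1)%:E <= J f].
have D_int k f : D k f -> mu.-integrable [set: X] (gain f).
  by move=> [Cf Jf]; apply: integrable_gain => //; apply: lt_le_trans Jf; rewrite ltNyr.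
have [f [g [Df Cg fg]]] : exists (f : (X -> R)^nat) g, [/\ forall k, D k (f k),
    C g & {ae mu, forall x, f k x @[k --> \oo] --> g x}].
  apply: ae_cvg_selection => //.
  - by move=> k f [].
  - move=> k; have e0 : (0 < k.+1%:R^-1 :> R)%R by rewrite invr_gt0.
    have [_ [f Cf <-] Jf] := ub_ereal_sup_adherent e0 s_fin.
    by exists f; split => //; rewrite EFinB -sE ltW.
  - move=> m n mn f [Cf Jf]; split => //; apply: le_trans Jf.
    by rewrite lee_fin lerB// lef_pV2 ?posrE// ler_nat.
  - move=> k f h Df Dh; have [[Cf Jf] [Ch Jh]] := (Df, Dh).
    split; first exact: real_e_values_midpoint.
    have if2 : mu.-integrable [set: X] (fun x => (2^-1)%:E * gain f x).
      by apply: integrableZl => //; exact: D_int Df.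
    have ih2 : mu.-integrable [set: X] (fun x => (2^-1)%:E * gain h x).
      by apply: integrableZl => //; exact: D_int Dh.
    apply: (@le_trans _ _
        (\int[mu]_x ((2^-1)%:E * gain f x + (2^-1)%:E * gain h x))).
      rewrite integralD// !integralZl//; [|exact: D_int Dh|exact: D_int Df].
      set c := (S - k.+1%:R^-1)%R in Jf Jh *.
      rewrite (_ : c%:E = (2^-1)%:E * c%:E + (2^-1)%:E * c%:E); last first.
        by rewrite -EFinM -EFinD; congr (_%:E); field.
      by apply: leeD; apply: lee_wpmul2l => //; rewrite lee_fin invr_ge0.
    apply: le_integral_pointwise.
    - by have /integrableP[] := integrableD measurableT if2 ih2.
    - by apply: measurable_gain; exact: real_e_values_midpoint.
    - by move=> x; exact: gain_midpoint.
have Jg_ge eta : (0 < eta)%R ->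
    mu.-integrable [set: X] (gain g) /\ (S - eta * 4)%:E <= J g.
  move=> eta0; have [a a0 Va] := V_sublinear eta0.
  pose B h x := (a + eta * (h x / w x))%:E.
  have iB h : C h -> mu.-integrable [set: X] (B h).
    exact: (integrable_sublinear_bound a (ltW eta0)).
  have mB h : C h -> measurable_fun [set: X] (B h) by move=> /iB/integrableP[].
  have mN h : C h -> measurable_fun [set: X] (fun x => B h x - gain h x).
    by move=> Ch; apply: emeasurable_funB; [exact: mB|exact: measurable_gain].
  have N0 h x : C h -> 0 <= B h x - gain h x.
    by move=> Ch; rewrite subre_ge0//; apply: Va; exact: real_e_values_ge0 Ch x.
  set A := \int[mu]_x (cst a%:E x).
  have Afin : A \is a fin_num by exact: int_cst.
  have Cf k : C (f k) by have [] := Df k.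
  have IN : \int[mu]_x (B g x - gain g x) <= (fine A + eta * 4 - S)%:E.
    apply: (@fatou_le _ _ _ mu (fun k x => B (f k) x - gain (f k) x)).
    - by move=> k; exact: mN.
    - by move=> k x; exact: N0.
    - exact: mN.
    - by move=> x; exact: N0.
    - apply: filterS fg => x fgx; apply: le_limn_einf_gain => //.
        exact: real_e_values_ge0 Cg x.
      by move=> k; exact: real_e_values_ge0 (Cf k) x.
    - move=> k; rewrite integralB//; [|exact: iB|exact: D_int (Df k)].
      have [_ Jf] := Df k; have /andP[_ BA] := int_B (f k) a eta eta0 (Cf k).
      apply: le_trans (leeB BA Jf) _.
      by rewrite -/A -[in leLHS](fineK Afin) -EFinD lee_fin opprB addrA [leRHS]addrAC.
  have iN : mu.-integrable [set: X] (fun x => B g x - gain g x).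
    apply/integrableP; split; first exact: mN.
    under eq_integral do rewrite gee0_abs ?N0//.
    by apply: le_lt_trans IN _; rewrite ltry.
  have gE : gain g = (fun x => B g x - (B g x - gain g x)).
    apply/funext => x; rewrite /B.
    have := sublinear_utility_lty x (real_e_values_ge0 Cg x); rewrite /gain.
    case: (V (g x)) => [t| |] // _.
    by rewrite -!EFinB; congr (_%:E); ring.
  have ig : mu.-integrable [set: X] (gain g).
    by rewrite gE; apply: integrableB => //; exact: iB.
  split => //.
  have Jfin : J g \is a fin_num by exact: integrable_fin_num.
  have /andP[Bge _] := int_B g a eta eta0 Cg.
  move: IN; rewrite integralB//; last exact: iB.
  rewrite -/(J g) -(fineK Jfin) leeBlDr// => IN.
  have := le_trans Bge IN; rewrite -/A -[in leLHS](fineK Afin) -EFinD !lee_fin.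
  lra.
have [ig _] := Jg_ge 1%R ltr01.
exists g; split => // f' Cf'; apply: le_trans (J_S _ Cf') _.
apply/lee_subgt0Pr => e e0.
have e4 : (0 < e / 4)%R by rewrite divr_gt0.
have [_] := Jg_ge _ e4; rewrite divfK// EFinB.
Qed.

End optimum.

(** * Integrals of differences *)

Section comparison.
Context d (X : measurableType d) (R : realType).
Variable mu : {measure set X -> \bar R}.
Implicit Types F G : X -> \bar R.

Lemma funeneg_diff_le F G x : (G \- F)^\- x <= G^\- x + F^\+ x.
Proof.
rewrite funeneg.unlock funepos.unlock /=.
have m0 (a : \bar R) : 0 <= maxe a 0 by rewrite le_max lexx orbT.
rewrite ge_max adde_ge0// andbT.
have GN : - G x <= maxe (- G x) 0 by rewrite le_max lexx.
have FP : F x <= maxe (F x) 0 by rewrite le_max lexx.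
move: (m0 (- G x)) (m0 (F x)) GN FP.
move: (maxe (- G x) 0) (maxe (F x) 0) => p q.
case: (G x) (F x) => [s| |] [r| |]; case: p => [p| |]; case: q => [q| |] //=;
  try by move=> *; rewrite ?leNye ?addey ?addye ?leey.
by rewrite -EFinD !lee_fin; lra.
Qed.

(** The integral of F may be -oo. If the positive part of G - F has infinite
integral there is nothing to compare; otherwise G - F is integrable, and F agrees
almost everywhere with the difference of two integrable functions. *)
Lemma integral_diff_ge0 F G :
  measurable_fun [set: X] F -> \int[mu]_x F^\+ x < +oo ->
  mu.-integrable [set: X] G -> \int[mu]_x F x <= \int[mu]_x G x ->
  \int[mu]_x (G \- F)^\- x < +oo /\ 0 <= \int[mu]_x (G x - F x).
Proof.
move=> mF Fpos iG FG; have mG : measurable_fun [set: X] G by case/integrableP: iG.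
have mD : measurable_fun [set: X] (G \- F) by exact: emeasurable_funB.
have Dneg : \int[mu]_x (G \- F)^\- x < +oo.
  apply: (@le_lt_trans _ _ (\int[mu]_x (G^\- x + F^\+ x))).
    apply: ge0_le_integral => //; first exact: measurable_funeneg.
      apply: emeasurable_funD; first exact: measurable_funeneg.
      exact: measurable_funepos.
    by move=> x _; exact: funeneg_diff_le.
  rewrite ge0_integralD//; [|exact: measurable_funeneg|exact: measurable_funepos].
  by rewrite lte_add_pinfty// integral_funeneg_lt_pinfty.
split => //; have [Dpos|] := ltP (\int[mu]_x (G \- F)^\+ x) +oo; last first.
  rewrite leye_eq => /eqP Dy; rewrite integralE Dy.
  have nfin : \int[mu]_x (G \- F)^\- x \is a fin_num.
    by rewrite ge0_fin_numE// integral_ge0.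
  by rewrite -(fineK nfin) leey.
have iD : mu.-integrable [set: X] (G \- F).
  apply: integrable_of_integral_gtNy => //.
  rewrite integralE.
  have nfin : \int[mu]_x (G \- F)^\- x \is a fin_num.
    by rewrite ge0_fin_numE// integral_ge0.
  have pfin : \int[mu]_x (G \- F)^\+ x \is a fin_num.
    by rewrite ge0_fin_numE// integral_ge0.
  by rewrite -(fineK nfin) -(fineK pfin) ltNyr.
move: FG; rewrite (ae_eq_integral (fun x => G x - (G \- F) x))//; last 2 first.
- exact: emeasurable_funB.
- apply: filterS (integrable_ae measurableT iG) => x /(_ I) Gx _ /=.
  move: Gx; case: (G x) => [s| |]// _; case: (F x) => [r| |]//.
  by rewrite -!EFinB; congr (_%:E); ring.
rewrite integralB//.
have Gfin := integrable_fin_num measurableT iG.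
have Dfin := integrable_fin_num measurableT iD.
rewrite -(fineK Gfin) -(fineK Dfin) -EFinB !lee_fin.
by rewrite gerBl.
Qed.

End comparison.

(** * Concave utilities with logarithmic growth *)

Section utility.
Context {R : realType}.
Variable V : R -> \bar R.
Hypothesis V_concave : concave_on [set y : R | (0 <= y)%R] V.
Hypothesis V_fin : forall y : R, (0 < y)%R -> V y \is a fin_num.

Lemma utility_lty y : (0 <= y)%R -> V y < +oo.
Proof.
rewrite le_eqVlt => /predU1P[<-|y0]; last by rewrite ltey_eq V_fin.
have t01 : (0 < (2^-1 : R) < 1)%R by lra.
have := @V_concave 0%R 1%R _ (lexx _) ler01 t01.
rewrite (_ : 2^-1 * 0 + (1 - 2^-1) * 1 = 2^-1 :> R)%R; last by field.
have h0 : (0 < 2^-1 :> R)%R by rewrite invr_gt0.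
rewrite -(fineK (V_fin h0)) -(fineK (V_fin ltr01)).
case: (V 0%R) => [r| |]//; first by rewrite ltry.
by rewrite gt0_muley ?lte_fin// addye// leye_eq.
Qed.

Lemma utility_concave_real (x y z : R) (a b c : R) :
  (0 <= x)%R -> (x < y)%R -> (y < z)%R ->
  V x = a%:E -> V y = b%:E -> V z = c%:E ->
  ((z - y) * a + (y - x) * c <= (z - x) * b)%R.
Proof.
move=> x0 xy yz Vx Vy Vz; have zx : (0 < z - x)%R by lra.
have z0 : (0 <= z)%R by lra.
pose t := ((z - y) / (z - x))%R.
have t01 : (0 < t < 1)%R.
  by rewrite divr_gt0 ?ltr_pdivrMr//; lra.
have := @V_concave x z t x0 z0 t01.
rewrite (_ : t * x + (1 - t) * z = y)%R; last by rewrite /t; field; rewrite gt_eqF.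
rewrite Vx Vy Vz -!EFinM -EFinD lee_fin => h.
rewrite -(ler_pM2l zx) in h; apply: le_trans h.
by rewrite le_eqVlt; apply/orP; left; apply/eqP; rewrite /t; field; rewrite gt_eqF.
Qed.

(** If V x > V y for some x < y, then V stays below V y to the right of y, and to
the left of y it lies below the chord through y and y + 1; so V is bounded. *)
Lemma utility_unbounded_nondecreasing :
  ~ (exists b : R, forall y, (0 <= y)%R -> V y <= b%:E) ->
  forall x y, (0 <= x)%R -> (x <= y)%R -> V x <= V y.
Proof.
move=> Vunb x y x0; rewrite le_eqVlt => /predU1P[->//|xy].
rewrite leNgt; apply/negP => Vyx; apply: Vunb.
have y0 : (0 < y)%R by lra.
have y10 : (0 < y + 1)%R by lra.
have [a Va] : exists a, V x = a%:E.
  move: Vyx (utility_lty x0); rewrite -(fineK (V_fin y0)).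
  by case: (V x) => [a| |]// _ _; exists a.
have Vb := esym (fineK (V_fin y0)); have Ve := esym (fineK (V_fin y10)).
set b := fine (V y) in Vb; set e := fine (V (y + 1)%R) in Ve.
exists (`|b| * (y + 1) + `|e| * y)%R => u u0.
have b_le : (b <= `|b| * (y + 1) + `|e| * y)%R.
  have := ler_norm b; have := normr_ge0 b; have := normr_ge0 e; nra.
have [uy|yu|->] := ltgtP u y; last by rewrite Vb lee_fin.
- move: (utility_lty u0); case Vc : (V u) => [c| |]// _; last by rewrite leNye.
  have yy1 : (y < y + 1)%R by lra.
  have := utility_concave_real u0 uy yy1 Vc Vb Ve.
  rewrite lee_fin (_ : y + 1 - y = 1)%R ?mul1r; last by ring.
  move=> h; have := ler_norm b; have := normr_ge0 b; have := normr_ge0 e.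
  have : (- e <= `|e|)%R by rewrite -normrN ler_norm.
  clear -h u0 uy; nra.
- have u1 : (0 < u)%R by lra.
  have Vc := esym (fineK (V_fin u1)); set c := fine (V u) in Vc.
  have := utility_concave_real x0 xy yu Va Vb Vc.
  rewrite Vc lee_fin => h; apply: le_trans b_le.
  move: Vyx; rewrite Va Vb lte_fin => ba.
  rewrite -(ler_pM2l (_ : 0 < y - x)%R); [nra|lra].
Qed.

(** Apply ln s <= s to s = r / c and choose c = (K + 1) / eta, so that K / c is at
most eta. *)
Lemma ln_sublinear (K eta r : R) : (0 <= K)%R -> (0 < eta)%R -> (0 < r)%R ->
  (K * ln r <= K * `|ln ((K + 1) / eta)| + eta * r)%R.
Proof.
move=> K0 eta0 r0; have K1 : (0 < K + 1)%R by lra.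
pose c := ((K + 1) / eta)%R; have c0 : (0 < c)%R by rewrite divr_gt0.
have rc : (0 < r / c)%R by rewrite divr_gt0.
have lnr : (ln r = ln c + ln (r / c))%R.
  by rewrite -lnM ?posrE// mulrC divfK// gt_eqF.
have lnrc : (ln (r / c) <= r / c)%R.
  rewrite (_ : r / c = 1 + (r / c - 1))%R; last by ring.
  by apply: le_trans (le_ln1Dx _) _; lra.
have Krc : (K * (r / c) <= eta * r)%R.
  rewrite /c invf_div mulrA -subr_ge0.
  rewrite (_ : _ - _ = eta * r / (K + 1))%R; last by field; rewrite gt_eqF.
  by rewrite divr_ge0 ?mulr_ge0 ?ltW.
have h1 := ler_wpM2l K0 (ler_norm (ln c)).
have h2 := ler_wpM2l K0 lnrc.
by rewrite lnr mulrDr -/c; lra.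
Qed.

Lemma utility_log_growth_sublinear (K eta x y : R) :
  (forall x y : R, (0 <= x)%R -> (x <= y)%R -> V x <= V y) ->
  (forall x y : R, (1 <= x)%R -> (x <= y)%R ->
     V y - V x <= (K * ln (y / x))%:E) ->
  (0 <= K)%R -> (0 < eta)%R -> (1 <= x)%R -> (0 <= y)%R ->
  V y - V x <= (K * `|ln ((K + 1) / eta)| + eta * (y / x))%:E.
Proof.
move=> Vmono Vlog K0 eta0 x1 y0; have x0 : (0 < x)%R by lra.
have [xy|/ltW yx] := leP x y.
  apply: le_trans (Vlog _ _ x1 xy) _; rewrite lee_fin; apply: ln_sublinear => //.
  by rewrite divr_gt0//; lra.
apply: (@le_trans _ _ 0); last first.
  by rewrite lee_fin addr_ge0// mulr_ge0 ?divr_ge0// ltW.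
by rewrite leeBlDr ?V_fin// add0e; exact: Vmono.
Qed.

End utility.

(** * Existence of an optimal e-value *)

Section optimal_e_value.
Context d (X : measurableType d) (R : realType).
Variable H : set (probability X R).
Variable mu : {measure set X -> \bar R}.
Hypothesis mu_le1 : mu [set: X] <= 1.
Hypothesis mu_ac : forall N : set X, H_negligible H N -> mu N = 0.
Variable U : \bar R -> \bar R.
Hypothesis mU : measurable_fun [set u : \bar R | 0 <= u] U.

Local Notation C := (real_e_values H).
Local Notation V := (fun y : R => U y%:E).

Hypothesis V_concave : concave_on [set y : R | (0 <= y)%R] V.
Hypothesis V_usc : upper_semicontinuous_on [set y : R | (0 <= y)%R] V.
Hypothesis V_fin : forall y : R, (0 < y)%R -> V y \is a fin_num.

Lemma measurable_utility (e : X -> \bar R) : measurable_fun [set: X] e ->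
  (forall x, 0 <= e x) -> measurable_fun [set: X] (U \o e).
Proof.
move=> me e0; apply: measurable_comp mU me => //.
- rewrite (_ : [set u | _] = [set` `[0%E, +oo[ ]); first exact: emeasurable_itv.
  by apply/seteqP; split => u /=; rewrite in_itv/= andbT.
- by move=> _ [x _ <-] /=.
Qed.

Lemma measurable_real_utility (f : X -> R) : measurable_fun [set: X] f ->
  (forall x, 0 <= f x)%R -> measurable_fun [set: X] (V \o f).
Proof.
move=> mf f0; apply: (@measurable_utility (EFin \o f)).
  exact/measurable_EFinP.
by move=> x; rewrite lee_fin.
Qed.

(** The reference cancels in U(g) - U(e) wherever U(g) is finite, which is almost
everywhere because the gain of g is integrable. *)
Lemma U_optimal_of_gain_optimal (v g : X -> R) : measurable_fun [set: X] v ->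
  C g -> mu.-integrable [set: X] (gain V v g) ->
  (forall f, C f -> \int[mu]_x (gain V v f)^\+ x < +oo) ->
  (forall f, C f -> \int[mu]_x gain V v f x <= \int[mu]_x gain V v g x) ->
  U_optimal H mu U (EFin \o g).
Proof.
move=> mv Cg ig gpos gopt; split => // e He; have Cf := fine_e_values He.
set f := fine \o e in Cf; have [me e0 _] := He.
have mgain h : C h -> measurable_fun [set: X] (gain V v h).
  move=> Ch; apply: emeasurable_funB; last exact/measurable_EFinP.
  by apply: measurable_real_utility;
    [exact: real_e_values_measurable Ch|exact: real_e_values_ge0 Ch].
have [Dneg D0] := integral_diff_ge0 (mgain f Cf) (gpos f Cf) ig (gopt f Cf).
have Vg_fin : {ae mu, forall x, U (g x)%:E \is a fin_num}.
  apply: filterS (integrable_ae measurableT ig) => x /(_ I).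
  by rewrite /gain; case: (U (g x)%:E).
have DE : {ae mu, forall x, U (g x)%:E - U (e x) = gain V v g x - gain V v f x}.
  apply: filterS2 Vg_fin (e_values_ae_fin mu_ac He) => x Vgx ex.
  rewrite /gain {1}ex -/(f x) -(fineK Vgx).
  case: (U (f x)%:E) => [r| |]//.
  by rewrite -!EFinB; congr (_%:E); ring.
have mgV : measurable_fun [set: X] (U \o (EFin \o g)).
  by apply: measurable_utility; case: Cg.
have meV : measurable_fun [set: X] (U \o e) by exact: measurable_utility.
have mD : measurable_fun [set: X] ((U \o (EFin \o g)) \- (U \o e)).
  exact: emeasurable_funB.
have mD' : measurable_fun [set: X] (gain V v g \- gain V v f).
  by apply: emeasurable_funB; exact: mgain.
split; last first.
  rewrite (ae_eq_integral (gain V v g \- gain V v f))//.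
  by apply: filterS DE => x + _.
split.
  by apply: filterS Vg_fin => x Vgx; rewrite fin_num_adde_defr.
right; rewrite (ae_eq_integral (gain V v g \- gain V v f)^\-)//.
- exact: measurable_funeneg.
- exact: measurable_funeneg.
- by apply: filterS DE => x Dx _; rewrite funeneg.unlock /= Dx.
Qed.

(** A utility bounded above needs no control by the numeraire. An unbounded one is
nondecreasing, so that raising z to max(z,1) costs at most V(1) - V(1/2), and
the growth condition compares any larger value with max(z,1). *)
Lemma exists_U_optimal (K : R) : (0 <= K)%R ->
  (forall x y : R, (1 <= x)%R -> (x <= y)%R ->
     U y%:E - U x%:E <= (K * ln (y / x))%:E) ->
  exists estar : X -> \bar R, U_optimal H mu U estar.
Proof.
move=> K0 Vlog.
have [z [Cz z2 zopt]] := numeraire_exists mu_le1 mu_ac.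
pose w x : R := Num.max (z x) 1%R.
have mz := real_e_values_measurable Cz.
have mw : measurable_fun [set: X] w by exact: measurable_maxr.
have w1 x : (1 <= w x)%R by rewrite le_max lexx orbT.
have w0 x : (0 < w x)%R by apply: lt_le_trans (w1 x).
suff [v [z0 [mv Vsub Cz0 Jz0]]] : exists v z0 : X -> R,
    [/\ measurable_fun [set: X] v,
     forall eta : R, (0 < eta)%R -> exists2 a : R, (0 <= a)%R &
       forall x y, (0 <= y)%R -> V y - (v x)%:E <= (a + eta * (y / w x))%:E,
     C z0 & -oo < \int[mu]_x gain V v z0 x].
  have [g [Cg ig gopt]] := exists_optimum mu_le1 mu_ac measurable_real_utility
    V_concave V_usc mv mw w0 zopt Vsub (ex_intro2 _ _ z0 Cz0 Jz0).
  exists (EFin \o g); apply: (U_optimal_of_gain_optimal mv) => // f Cf.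
  exact: (integral_gain_lty mu_le1 measurable_real_utility mv mw w0 zopt Vsub Cf).
have [[b Vb]|Vunb] := pselect (exists b : R, forall y, (0 <= y)%R -> V y <= b%:E).
  have V1 : U 1%:E \is a fin_num by exact: V_fin.
  exists (cst (fine (V 1%R))), (cst 1%R); split => //.
  - move=> eta eta0; exists `|b - fine (V 1%R)|%R => // x y y0.
    apply: (@le_trans _ _ (b - fine (V 1%R))%:E).
      by rewrite EFinB; apply: leeB => //; exact: Vb.
    rewrite lee_fin; apply: le_trans (ler_norm _) _; rewrite lerDl.
    by rewrite mulr_ge0 ?divr_ge0// ltW.
  - exact: real_e_values1.
  - rewrite (_ : gain _ _ _ = cst 0); first by rewrite integral_cst// mul0e.
    by apply/funext => x; rewrite /gain /cst fineK// subee.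
have Vmono := utility_unbounded_nondecreasing V_concave V_fin Vunb.
have Vw x : ((fine \o (V \o w)) x)%:E = V (w x) by rewrite fineK// V_fin.
exists (fine \o (V \o w)), z; split => //.
- apply: (@measurableT_comp _ _ _ _ _ _ fine); first exact: fine_measurable.
  by apply: measurable_real_utility => // x; exact: ltW.
- move=> eta eta0; exists (K * `|ln ((K + 1) / eta)|)%R; first by rewrite mulr_ge0.
  move=> x y y0; rewrite Vw.
  by apply: (utility_log_growth_sublinear V_fin Vmono Vlog K0 eta0 (w1 x)).
have h0 : (0 < 2^-1 :> R)%R by rewrite invr_gt0.
pose c : R := (fine (V 2^-1%R) - fine (V 1%R))%R.
have z_ge x : (2^-1 <= z x)%R -> c%:E <= gain V (fine \o (V \o w)) z x.
  move=> zx; rewrite /gain Vw /w.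
  have Vzfin : V (z x) \is a fin_num by apply: V_fin; lra.
  have [x1|x1] := leP (z x) 1%R.
    rewrite /c EFinB !fineK ?V_fin//; apply: leeB => //; apply: Vmono => //.
  rewrite subee// lee_fin subr_le0; apply: fine_le; rewrite ?V_fin//.
  by apply: Vmono; lra.
have mgz : measurable_fun [set: X] (gain V (fine \o (V \o w)) z).
  apply: emeasurable_funB; last first.
    apply/measurable_EFinP.
    apply: (@measurableT_comp _ _ _ _ _ _ fine); first exact: fine_measurable.
    by apply: measurable_real_utility => // x; exact: ltW.
  by apply: measurable_real_utility => //; exact: real_e_values_ge0 Cz.
(* The lower bound c holds only almost everywhere, as z >= 1/2 does. *)
rewrite (ae_eq_integral (fun x => maxe (gain V (fine \o (V \o w)) z x) c%:E))//.
- apply: (@lt_le_trans _ _ (\int[mu]_x (cst c%:E x))).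
    rewrite ltNye_eq; apply/orP; left; apply: integrable_fin_num => //.
    exact: integrable_cst_le1.
  apply: le_integral_pointwise => //; first exact: measurable_maxe.
  by move=> x; rewrite le_max lexx orbT.
- exact: measurable_maxe.
- by apply: filterS z2 => x /z_ge cz _; rewrite max_l.
Qed.

End optimal_e_value.

Theorem corollary4 (R : realType) (d : measure_display) (X : measurableType d)
    (H : set (probability X R)) (Q : probability X R)
    (Qa Qs : {measure set X -> \bar R}) (U : \bar R -> \bar R)
    (hQ : generalized_lebesgue_decomposition H Q Qa Qs)
    (hUmeas : measurable_fun [set u : \bar R | 0 <= u] U)
    (hUconcave : concave_on [set x : R | (0 <= x)%R] (fun x : R => U x%:E))
    (hUusc : upper_semicontinuous_on [set x : R | (0 <= x)%R]
               (fun x : R => U x%:E))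
    (hUfin : forall x : R, (0 < x)%R -> U x%:E \is a fin_num)
    (hUgrowth : exists2 K : R, (0 <= K)%R &
       forall x y : R, (1 <= x)%R -> (x <= y)%R ->
         U y%:E - U x%:E <= (K * ln (y / x))%:E) :
  exists estar : X -> \bar R, U_optimal H Qa U estar.
Proof.
have [Qsum _ Qa_ac] := hQ; have [K K0 Ulog] := hUgrowth.
have Qa_le1 : Qa [set: X] <= 1.
  rewrite -(probability_setT Q) Qsum//; exact: leeDl.
exact: (exists_U_optimal Qa_le1 Qa_ac hUmeas hUconcave hUusc hUfin K0 Ulog).
Qed.
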